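(* Let $X$ be a nonempty set and let $\operatorname{cl}_1 \colon X \to 2^X$ be a mapping. Then the following statements are equivalent: (1) There exists a $T_0$-topology $\tau \in \boldsymbol{\tau}_0(X)$ such that the equality $\operatorname{cl}_{\tau}(\{x\}) = \operatorname{cl}_1(x)$ holds for each $x \in X$. (2) The mapping $\operatorname{cl}_1 \colon X \to 2^X$ is injective, and $x \in \operatorname{cl}_1(x)$ for each $x \in X$, and the inclusion $\operatorname{cl}_1(y) \subseteq \operatorname{cl}_1(x)$ holds for every $x \in X$ and every $y \in \operatorname{cl}_1(x)$. (3) There exists a unique Alexandroff topology $\tau \in \boldsymbol{\tau}_0(X)$ such that the equality $\operatorname{cl}_{\tau}(\{x\}) = \operatorname{cl}_1(x)$ holds for each $x \in X$.
   Context: For a set $X$, $2^X$ denotes the set of all subsets of $X$. For a topological space $(X, \tau)$ and $A \subseteq X$, $\operatorname{cl}_{\tau}(A)$ denotes the closure of $A$ in $(X,\tau)$. A topological space $(X,\tau)$ is a $T_0$-space if for any two distinct points $x, y \in X$ there is an open set $O \in \tau$ containing exactly one of $x$ and $y$; in this case $\tau$ is called a $T_0$-topology. $\boldsymbol{\tau}_0(X)$ denotes the set of all $T_0$-topologies on $X$. A topological space $(X,\tau)$ is an Alexandroff space (and $\tau$ is an Alexandroff topology) if the intersection of an arbitrary family of open subsets is open. *)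

(* Defs.v *)
From HB Require Import structures.
From mathcomp Require Import all_boot all_order.
From mathcomp Require Import boolp classical_sets functions topology.

Set Implicit Arguments.
Unset Strict Implicit.
Unset Printing Implicit Defensive.

Local Open Scope classical_set_scope.

(* A topology as a first-class object, so that one can quantify over the
   topologies on a fixed carrier and speak of uniqueness. *)
Record topology (X : Type) := Topology {
  opens : set (set X) ;
  opens_setT : opens setT ;
  opens_setI : forall A B, opens A -> opens B -> opens (A `&` B) ;
  opens_bigcup : forall F : set (set X),
    F `<=` opens -> opens (\bigcup_(A in F) A) }.

Lemma topology_eq (X : Type) (t1 t2 : topology X) :
  opens t1 = opens t2 -> t1 = t2.
Proof.
case: t1 t2 => [o1 a1 b1 c1] [o2 a2 b2 c2] /= e.
by case: _ / e a2 b2 c2 => a2 b2 c2; congr Topology; exact: Prop_irrelevance.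
Qed.

(* The carrier X seen as a [topologicalType] whose open sets are [opens tau].
   The choice structure required by the hierarchy comes from classical logic,
   so X is an arbitrary type. *)
Definition space (X : Type) (tau : topology X) : Type := X.

Section SpaceTopology.
Variables (X : Type) (tau : topology X).

HB.instance Definition _ := gen_eqMixin (space tau).
HB.instance Definition _ := gen_choiceMixin (space tau).

Let opens_bigU (I : Type) (f : I -> set (space tau)) :
  (forall i, opens tau (f i)) -> opens tau (\bigcup_i f i).
Proof.
move=> fo.
have -> : \bigcup_i f i = \bigcup_(A in range f) A by rewrite bigcup_image.
by apply: opens_bigcup => _ [i _ <-]; exact: fo.
Qed.

HB.instance Definition _ := isOpenTopological.Build (space tau)
  (opens_setT tau) (@opens_setI _ tau) opens_bigU.

End SpaceTopology.

Lemma open_spaceE (X : Type) (tau : topology X) :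
  (open : set (set (space tau))) = opens tau.
Proof.
apply/seteqP; split=> A; rewrite openE /interior /=.
  move=> oA.
  have -> : A = \bigcup_(B in [set B | opens tau B /\ B `<=` A]) B.
    apply/seteqP; split=> [x Ax|x [B [_ BA]] Bx]; last exact: BA.
    by have [B [oB Bx BA]] := oA x Ax; exists B.
  by apply: opens_bigcup => B [].
by move=> oA x Ax; exists A; split.
Qed.

Definition cl (X : Type) (tau : topology X) (A : set X) : set X :=
  closure (A : set (space tau)).

Definition T0 (X : Type) (tau : topology X) : Prop :=
  kolmogorov_space (space tau).

Lemma T0E (X : Type) (tau : topology X) :
  T0 tau <-> forall x y : X, x <> y ->
    exists2 O, opens tau O & (O x /\ ~ O y) \/ (O y /\ ~ O x).
Proof.
have nbhsE_ (x : X) (A : set X) : nbhs (x : space tau) A <->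
    exists O, [/\ opens tau O, O x & O `<=` A].
  split=> [|[O [oO Ox OA]]].
    by rewrite nbhsE => -[O [oO Ox] OA]; exists O; split; rewrite -?open_spaceE.
  by rewrite nbhsE; exists O => //; split; rewrite ?open_spaceE.
split=> [k x y xy | h x y /eqP xy].
  have [|A [[]|[]]] := k x y; first exact/eqP.
  - rewrite !inE => /nbhsE_[O [oO Ox OA]] Ay.
    by exists O => //; left; split=> // /OA.
  - rewrite !inE => /nbhsE_[O [oO Oy OA]] Ax.
    by exists O => //; right; split=> // /OA.
have [O oO [[Ox Oy]|[Oy Ox]]] := h x y xy; exists O; rewrite !inE.
  by left; split=> [|/=]; first by apply/nbhsE_; exists O; split.
by right; split=> [|/=]; first by apply/nbhsE_; exists O; split.
Qed.

Definition alexandroff (X : Type) (tau : topology X) : Prop :=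
  forall F : set (set (space tau)),
    F `<=` open -> open (\bigcap_(A in F) A).

(* Main.v *)
Require Import Defs.
From mathcomp Require Import all_boot all_order.
From mathcomp Require Import boolp classical_sets functions topology.

Set Implicit Arguments.
Unset Strict Implicit.
Unset Printing Implicit Defensive.

Local Open Scope classical_set_scope.

(** A topology is determined by its point closures only up to the choice of
    which up-sets of the specialization preorder are declared open.  The point
    [y] lies in the closure of [x] exactly when every open set around [y]
    contains [x] ([cl_set1E]), so [x |-> cl {x}] encodes a preorder; this gives
    the reflexivity and transitivity conditions, and separation by open sets
    says that the preorder is antisymmetric, that is, that points with equal
    closures coincide ([T0_cl_set1]).

    Conversely, given a map [cl1] encoding a preorder, declare open all the
    sets [O] that contain [x] as soon as they meet [cl1 x].  This family is
    stable under arbitrary unions and intersections, and its point closures are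
    [cl1] again ([cl_upset_topology]): the test set that detects them is
    [{z | y \in cl1 z}], the least open neighbourhood of [y].

    It is the only such Alexandroff topology: every open set of any topology is
    an up-set, and in an Alexandroff space the up-set generated by a point is
    the intersection of its open neighbourhoods, hence open, so that all up-sets
    are open ([alexandroff_opensE]). *)

Section PointClosures.
Variables (X : Type) (tau : topology X).

Lemma cl_set1E (x y : X) :
  cl tau [set x] y <-> forall O, opens tau O -> O y -> O x.
Proof.
split=> [clxy O oO Oy|sep B].
  have /clxy[_ [-> //]] : nbhs (y : space tau) O.
  by rewrite nbhsE; exists O => //; split; rewrite ?open_spaceE.
rewrite nbhsE => -[O [oO Oy] OB]; exists x; split=> //.
by apply: OB; apply: sep => //; rewrite -open_spaceE.
Qed.

Lemma cl_set1_refl (x : X) : cl tau [set x] x.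
Proof. exact/cl_set1E. Qed.

Lemma cl_set1_trans (x y : X) :
  cl tau [set x] y -> cl tau [set y] `<=` cl tau [set x].
Proof.
move=> /cl_set1E yx z /cl_set1E zy; apply/cl_set1E => O oO Oz.
by apply: yx => //; exact: zy.
Qed.

(** Two points with equal closures lie in the closure of each other, hence in
    the same open sets; conversely, distinct points lying in the same open sets
    would have equal closures. *)
Lemma T0_cl_set1 : T0 tau <-> injective (fun x => cl tau [set x]).
Proof.
rewrite T0E; split=> [sep x y exy|inj x y xy].
  have /cl_set1E yx : cl tau [set x] y by rewrite exy; exact: cl_set1_refl.
  have /cl_set1E xy : cl tau [set y] x by rewrite -exy; exact: cl_set1_refl.
  apply: contrapT => /sep[O oO [[Ox]|[Oy]]]; apply; first exact: xy.
  exact: yx.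
apply: contrapT => nsep; apply/xy/inj/seteqP.
split; apply/cl_set1_trans/cl_set1E => O oO Oz; apply: contrapT => nOz;
  by apply: nsep; exists O; tauto.
Qed.

(** The union of the least open neighbourhoods of the points of an up-set is
    that up-set; each of them is an intersection of open sets. *)
Lemma alexandroff_opensE (O : set X) : alexandroff tau ->
  opens tau O <-> forall x y, cl tau [set x] y -> O y -> O x.
Proof.
move=> alex; split=> [oO x y /cl_set1E + Oy|upO]; first exact.
pose N y := \bigcap_(A in [set A | opens tau A /\ A y]) A.
have -> : O = \bigcup_(A in N @` O) A.
  apply/seteqP; split=> [y Oy|x [_ [y Oy <-] Nyx]].
    by exists (N y); [exists y | move=> A []].
  by apply: upO Oy; apply/cl_set1E => A oA Ay; exact: Nyx.
apply: opens_bigcup => _ [y Oy <-]; rewrite -open_spaceE.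
by apply: alex => A []; rewrite open_spaceE.
Qed.

End PointClosures.

Section UpsetTopology.
Variables (X : Type) (cl1 : X -> set X).

Definition upset (O : set X) := forall x y, cl1 x y -> O y -> O x.

Lemma upset_setT : upset setT.
Proof. by []. Qed.

Lemma upset_bigcap (F : set (set X)) :
  F `<=` upset -> upset (\bigcap_(A in F) A).
Proof. by move=> upF x y xy Fy A FA; apply: upF xy (Fy A FA). Qed.

Lemma upset_setI (A B : set X) : upset A -> upset B -> upset (A `&` B).
Proof.
by move=> upA upB x y xy [Ay By]; split; [exact: upA Ay | exact: upB By].
Qed.

Lemma upset_bigcup (F : set (set X)) :
  F `<=` upset -> upset (\bigcup_(A in F) A).
Proof. by move=> upF x y xy [A FA Ay]; exists A => //; apply: upF xy Ay. Qed.

Definition upset_topology : topology X :=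
  Topology upset_setT upset_setI upset_bigcup.

Lemma alexandroff_upset_topology : alexandroff upset_topology.
Proof. by move=> F; rewrite open_spaceE; exact: upset_bigcap. Qed.

(** Reflexivity puts [y] in the test set [{z | y \in cl1 z}], and transitivity
    makes that set open. *)
Lemma cl_upset_topology (x : X) :
  (forall x, cl1 x x) -> (forall x y, cl1 x y -> cl1 y `<=` cl1 x) ->
  cl upset_topology [set x] = cl1 x.
Proof.
move=> refl trans; apply/seteqP; split=> y.
  move=> /cl_set1E/(_ [set z | cl1 z y]); apply=> //= a b ab; exact: trans.
by move=> xy; apply/cl_set1E => O; apply.
Qed.

End UpsetTopology.

Theorem theorem3p1 (X : Type) (X_neq0 : [set: X] !=set0) (cl1 : X -> set X) :
  [<-> exists tau : topology X,
         T0 tau /\ (forall x, cl tau [set x] = cl1 x);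
       [/\ injective cl1,
           (forall x, x \in cl1 x) &
           (forall x y, y \in cl1 x -> cl1 y `<=` cl1 x)];
       exists! tau : topology X,
         [/\ alexandroff tau, T0 tau & forall x, cl tau [set x] = cl1 x]].
Proof.
tfae.
- move=> [tau [T0tau /funext <-]]; split; first exact/T0_cl_set1.
    by move=> x; rewrite inE; exact: cl_set1_refl.
  by move=> x y; rewrite inE; exact: cl_set1_trans.
- move=> [inj mem_refl mem_trans].
  have clE x : cl (upset_topology cl1) [set x] = cl1 x.
    apply: cl_upset_topology => [z|z y zy]; first exact/set_mem.
    exact/mem_trans/mem_set.
  exists (upset_topology cl1); split.
    split=> //; first exact: alexandroff_upset_topology.
    by apply/T0_cl_set1; rewrite (funext clE).
  move=> tau [alex _ cltau]; apply/topology_eq/predeqP => O.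
  apply: iff_trans (iff_sym (alexandroff_opensE O alex)).
  by split=> upO x y; move: (upO x y); rewrite cltau.
- by move=> [tau [[_ T0tau cltau] _]]; exists tau.
Qed.
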